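(* Let $\mathcal A$ be a commutative semiring with negation map $(-)$ and $\mathcal T\subseteq\mathcal A\setminus\{\mathbb 0\}$ a multiplicative submonoid containing $\mathbb 1$, such that $(\mathcal A,\mathcal T,(-))$ is a cancelative meta-tangible $\mathcal T$-triple. Let $A$ be an $n\times n$ matrix all of whose entries lie in $\mathcal T\cup\{\mathbb 0\}$. If the rows of $A$ are $\circ$-dependent, then $|A|\in\mathcal A^\circ$.
   Context: A commutative semiring: commutative associative addition with neutral $\mathbb 0$, commutative associative multiplication with identity $\mathbb 1$, distributive, $x\mathbb 0=\mathbb 0$. Negation map: $(-):\mathcal A\to\mathcal A$ with $(-)(x+y)=(-)x+(-)y$, $(-)((-)x)=x$, $(-)(xy)=((-)x)y$, $(-)\mathcal T\subseteq\mathcal T$. Write $x(-)y:=x+((-)y)$, $x^\circ:=x(-)x$, $\mathcal A^\circ=\{x^\circ:x\in\mathcal A\}$. $(\mathcal A,\mathcal T,(-))$ is a $\mathcal T$-triple if $\mathcal T\cap\mathcal A^\circ=\emptyset$ and every element of $\mathcal A$ is a finite sum of elements of $\mathcal T$; meta-tangible if $a+b\in\mathcal T$ for all $a,b\in\mathcal T$ with $b\neq(-)a$; cancelative if $ab_1=ab_2$ with $a\in\mathcal T$, $b_i\in\mathcal A$ implies $b_1=b_2$. A set of vectors $v_1,\dots,v_m\in\mathcal A^n$ is $\circ$-dependent if there are (some of) the $v_j$ and $\alpha_j\in\mathcal T$ with $\sum_j\alpha_jv_j\in(\mathcal A^n)^\circ$, i.e. every coordinate of $\sum_j\alpha_jv_j$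 lies in $\mathcal A^\circ$. The $(-)$-determinant is $|A|=\sum_{\pi\in S_n}(-)^\pi\prod_ia_{i,\pi(i)}$, where $(-)^\pi x$ is $x$ for even $\pi$ and $(-)x$ for odd $\pi$. *)

(* Defs.v *)
From HB Require Import structures.
From mathcomp Require Import all_boot all_order all_algebra all_fingroup.
Set Implicit Arguments. Unset Strict Implicit. Unset Printing Implicit Defensive.
Import GRing.Theory.
Local Open Scope ring_scope.

Section Defs.
Variable A : comPzSemiRingType.

Definition is_negation_map (T : A -> Prop) (neg : A -> A) : Prop :=
  [/\ forall x y, neg (x + y) = neg x + neg y,
      forall x, neg (neg x) = x,
      forall x y, neg (x * y) = neg x * y
    & forall x, T x -> T (neg x)].

Definition circ (neg : A -> A) (x : A) : A := x + neg x.

Definition in_circ (neg : A -> A) (y : A) : Prop := exists x, y = circ neg x.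

Definition is_T_triple (T : A -> Prop) (neg : A -> A) : Prop :=
  (forall x, T x -> ~ in_circ neg x) /\
  (forall x, exists s : seq A, (forall t, t \in s -> T t) /\ x = \sum_(t <- s) t).

Definition meta_tangible (T : A -> Prop) (neg : A -> A) : Prop :=
  forall a b, T a -> T b -> b <> neg a -> T (a + b).

Definition cancelative (T : A -> Prop) : Prop :=
  forall a b1 b2, T a -> a * b1 = a * b2 -> b1 = b2.

Definition neg_sign (neg : A -> A) n (s : 'S_n) (x : A) : A :=
  if odd_perm s then neg x else x.

Definition neg_det (neg : A -> A) n (M : 'M[A]_n) : A :=
  \sum_(s : 'S_n) neg_sign neg s (\prod_(i < n) M i (s i)).

Definition rows_circ_dependent (T : A -> Prop) (neg : A -> A) n (M : 'M[A]_n)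
  : Prop :=
  exists (S : {set 'I_n}) (alpha : 'I_n -> A),
    [/\ S != set0,
        forall j, j \in S -> T (alpha j)
      & forall k : 'I_n, in_circ neg (\sum_(j in S) alpha j * M j k)].
End Defs.

(* Main.v *)
Require Import Defs.
From HB Require Import structures.
From mathcomp Require Import all_boot all_order all_algebra all_fingroup.
From mathcomp Require Import boolp zify ring.
Import GRing.Theory.
Local Open Scope ring_scope.
Set Implicit Arguments. Unset Strict Implicit. Unset Printing Implicit Defensive.

(* After scaling the rows by the coefficients of the dependence (and cancelling at
   the end), the rows in a set S sum to a vector of elements x(-)x. The relation
   "t + s(-)s = t" induces a total quasi-order on T, so one may speak of the
   permutations s of maximal weight prod_x B x (s x). Write row j >= row i if
   replacing row i by row j in some permutation product reaches the maximal weight,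
   and take a strongly connected component C of this relation in S with nothing
   above it. A cycle of such replacements is a regular bipartite multigraph, hence
   a union of permutations; therefore no replacement of a row of C exceeds the
   maximum, and in each column the entries of C on maximal permutations are exactly
   the largest entries of S, if there are any.

   Either x + x(-)x = x for all x, or a + b is a or b whenever a <> (-)b. In the
   first case, replacing a row of C by the sum of the rows of S changes the
   determinant only by quasi-zeros, which it absorbs, and makes it a quasi-zero. In
   the second case only the maximal permutations matter; a quasi-zero column has its
   largest entries of both signs, or of even (or absorbing) multiplicity, and the
   claim is transferred to a vanishing determinant over the integers, or modulo 2. *)

(** * Optimal permutations *)

Section RegularMatrices.
Variable I : finType.

(** A duplicate-free path from [x] to [y], closed by the edge back to [x], is a simple cycle; [t]
    advances along it and fixes all other points. *)
Lemma perm_through_cycle (e : rel I) (x y : I) :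
  connect e x y -> e y x ->
  exists t : {perm I}, t y = x /\ forall z, t z = z \/ e z (t z).
Proof.
move=> /connectP[p ep ->] elx.
case/shortenP: ep elx => p' ep' up' _ elx.
have cyc : path.cycle e (x :: p') by rewrite /= rcons_path ep'.
have inj : injective (next (x :: p')) := can_inj (prev_next up').
exists (perm inj); split=> [|z]; rewrite permE.
  have <- : prev (x :: p') x = last x p'; last exact: next_prev.
  have /andP[xp' _] := up'.
  rewrite prev_nth mem_head; have -> : index x p' = size p'.
    by apply/eqP; rewrite eqn_leq index_size leqNgt index_mem.
  by rewrite -last_nth.
have [zp|zp] := boolP (z \in x :: p'); last by left; rewrite next_nth (negPf zp).
by right; apply: next_cycle.
Qed.

Definition regular (r : nat) (N : I -> I -> nat) :=
  (forall y, (\sum_k N y k)%N = r) /\ (forall k, (\sum_y N y k)%N = r).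

(** Matching theorem for regular bipartite multigraphs, by augmentation: if a permutation with the
    most positive entries had a zero entry at [x0], a cycle through [x0] would improve it. *)
Lemma regular_matching r (N : I -> I -> nat) :
  regular r.+1 N -> exists s : {perm I}, forall y, (0 < N y (s y))%N.
Proof.
move=> [rowN colN].
pose good (s : {perm I}) := #|[pred y | (0 < N y (s y))%N]|.
case: (@arg_maxnP _ 1%g xpredT good) => // s _ smax.
exists s => x0; rewrite lt0n; apply/negP => /eqP bad.
pose e := [rel x y | (0 < N x (s y))%N].
pose R := [pred y | connect e x0 y].
have rowR : (\sum_(x in R) \sum_(y in R) N x (s y) = #|R| * r.+1)%N.
  rewrite -sum_nat_const; apply: eq_bigr => x Rx.
  rewrite -(rowN x) [RHS](reindex_inj (@perm_inj _ s)) /=.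
  rewrite [RHS](bigID (mem R)) /= [X in (_ + X)%N]big1 ?addn0 // => y Ry.
  apply/eqP; rewrite -leqn0 leqNgt; apply/negP => exy; case/negP: Ry.
  by rewrite inE (connect_trans Rx) // connect1.
have colR : (\sum_(y in R) \sum_x N x (s y) = #|R| * r.+1)%N.
  by rewrite -sum_nat_const; apply: eq_bigr => y _.
(* The rows of [R] have all their weight in the columns [s y] with [y] in [R], and so exhaust those
   columns. Column [s x0] is therefore fed from within [R], which closes a cycle. *)
have colR0 : (\sum_(y in R) \sum_(x | x \notin R) N x (s y) = 0)%N.
  move: colR; under eq_bigr do rewrite (bigID (mem R)) /=.
  rewrite big_split /= exchange_big /= rowR => /eqP.
  by rewrite -[X in _ == X]addn0 eqn_add2l => /eqP.
have Rx0 : x0 \in R by rewrite inE connect0.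
have [y Ry eyx] : exists2 y, y \in R & e y x0.
  have := colN (s x0); rewrite (bigID (mem R)) /=.
  move: colR0 => /eqP; rewrite sum_nat_eq0 => /forallP/(_ x0).
  rewrite Rx0 /= => /eqP ->; rewrite addn0 => h.
  have : (\sum_(i in R) N i (s x0))%N != 0%N by rewrite h.
  rewrite sum_nat_eq0 negb_forall => /existsP[y].
  by rewrite negb_imply => /andP[Ry hy]; exists y => //; rewrite /= lt0n.
have [t [tyx te]] := perm_through_cycle Ry eyx.
have tx0 : e x0 (t x0).
  case: (te x0) => // tx0; case/negP: (lt0n_neq0 eyx).
  by rewrite (perm_inj (etrans tyx (esym tx0))) bad.
have := smax (t * s)%g isT; apply/negP; rewrite -ltnNge.
apply: proper_card; apply/properP; split.
  apply/subsetP => z; rewrite !inE => gz; rewrite permM.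
  by case: (te z) => [-> //|].
exists x0; rewrite !inE ?permM //.
by rewrite bad.
Qed.
End RegularMatrices.

(** * Weights of regular matrices and replacement of rows *)

Section OptimalPermutations.
Variables (I : finType) (A : comPzSemiRingType) (D : A -> Prop).
Variable le : A -> A -> Prop.
Hypothesis D1 : D 1.
Hypothesis DM : forall x y, D x -> D y -> D (x * y).
Hypothesis le_refl : forall x, D x -> le x x.
Hypothesis le_trans : forall x y z, le x y -> le y z -> le x z.
Hypothesis le_total : forall x y, D x -> D y -> le x y \/ le y x.
Hypothesis le_mul2l : forall u x y, D u -> le x y -> le (u * x) (u * y).
Variable B : I -> I -> A.
Hypothesis DB : forall j k, D (B j k).
Variable P : A.
Hypothesis DP : D P.
Hypothesis P_reg : forall x y, D x -> D y -> le (P * x) (P * y) -> le x y.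
Hypothesis P_max : forall s : {perm I}, le (\prod_x B x (s x)) P.

Definition optimal (s : {perm I}) := le P (\prod_x B x (s x)).

Let weight (N : I -> I -> nat) := \prod_y \prod_k B y k ^+ N y k.

Let D_prod (J : finType) (Q : pred J) (F : J -> A) :
  (forall j, D (F j)) -> D (\prod_(j | Q j) F j).
Proof. by move=> DF; apply: big_ind => // *; exact: DM. Qed.

Let D_exp x r : D x -> D (x ^+ r).
Proof. by move=> Dx; elim: r => [|r IH]; rewrite ?expr0 // exprS; exact: DM. Qed.

Let D_weight N : D (weight N).
Proof. by apply: D_prod => y; apply: D_prod => k; exact: D_exp. Qed.

Let le_mul x y x' y' : D x -> D y' -> le x y -> le x' y' -> le (x * x') (y * y').
Proof.
move=> Dx Dy' xy xy'; apply: (@le_trans _ (x * y')); first exact: le_mul2l.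
by rewrite ![_ * y']mulrC; exact: le_mul2l.
Qed.

Let expP_reg r x y : D x -> D y -> le (P ^+ r * x) (P ^+ r * y) -> le x y.
Proof.
move=> Dx Dy; elim: r => [|r IH]; first by rewrite !expr0 !mul1r.
by rewrite exprS -!mulrA => /P_reg h; apply: IH; apply: h; apply: DM => //; exact: D_exp.
Qed.

Let weightD N N' : weight (fun y k => N y k + N' y k)%N = weight N * weight N'.
Proof.
rewrite /weight -big_split /=; apply: eq_bigr => y _.
by rewrite -big_split /=; apply: eq_bigr => k _; rewrite exprD.
Qed.

Let prod_indicator (J : finType) (F : J -> A) j : \prod_k F k ^+ (j == k) = F j.
Proof.
rewrite (bigD1 j) //= eqxx expr1 big1 ?mulr1 // => k kj.
by rewrite eq_sym (negPf kj) expr0.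
Qed.

Let sum_indicator (J : finType) (j : J) : (\sum_k (j == k))%N = 1%N.
Proof.
by rewrite (bigD1 j) //= eqxx big1 ?addn0 // => k kj; rewrite eq_sym (negPf kj).
Qed.

(** Induction on [r], peeling off a matching: its weight is at most [P], that of the rest at most a
    power of [P]. If the product is tight, cancelling either bound makes the other factor tight. *)
Lemma regular_weight r N : regular r N ->
  le (weight N) (P ^+ r) /\
  (le (P ^+ r) (weight N) ->
   forall y k, (0 < N y k)%N -> exists s : {perm I}, optimal s /\ s y = k).
Proof.
elim: r N => [|r IH] N.
  move=> [rowN _]; have N0 y k : N y k = 0%N.
    by have /eqP := rowN y; rewrite sum_nat_eq0 => /forallP/(_ k)/eqP.
  split; last by move=> _ y k; rewrite N0.
  rewrite /weight big1 ?expr0 => [|y _]; first exact: le_refl.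
  by rewrite big1 // => k _; rewrite N0.
move=> regN; have [s Ns] := regular_matching regN; case: regN => rowN colN.
pose N' y k := (N y k - (s y == k))%N.
have NE y k : N y k = ((s y == k) + N' y k)%N.
  by rewrite subnKC //; case: eqP => // <-.
have wN : weight N = (\prod_y B y (s y)) * weight N'.
  have -> : weight N = weight (fun y k => (s y == k) + N' y k)%N.
    by apply: eq_bigr => y _; apply: eq_bigr => k _; rewrite NE.
  rewrite weightD; congr (_ * _); apply: eq_bigr => y _.
  exact: prod_indicator.
have regN' : regular r N'.
  split=> [y|k].
    have := rowN y; under eq_bigr do rewrite NE.
    by rewrite big_split /= sum_indicator => -[].
  have := colN k; under eq_bigr do rewrite NE.
  rewrite big_split /=.
  under eq_bigr do rewrite -(inj_eq (@perm_inj _ s^-1%g)) permK eq_sym.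
  by rewrite sum_indicator => -[].
have [leN' tightN'] := IH _ regN'.
have Ds : D (\prod_y B y (s y)) by exact: D_prod.
have DPr := D_exp r DP.
rewrite wN exprS; split; first exact: le_mul.
move=> le_wN y k; rewrite NE.
case: eqP => [syk _|_]; last first.
  rewrite add0n; apply: tightN'; apply: P_reg => //.
  apply: le_trans le_wN _; rewrite ![_ * weight N']mulrC.
  exact: le_mul2l.
exists s; split=> //; apply: (@expP_reg r) => //.
rewrite mulrC; apply: le_trans le_wN _; rewrite [X in le _ X]mulrC.
exact: le_mul2l.
Qed.

Definition replace (j i x : I) := if x == i then j else x.

Definition swap_weight j i (s : {perm I}) := \prod_x B (replace j i x) (s x).

Variable S : {set I}.

Let dominates : rel I := fun j i =>
  [&& j \in S, i \in S & `[< exists s, le P (swap_weight j i s) >]].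

(** The multigraph behind [swap_weight]: the permutation matrix of [s] with the edge of row [i]
    handed to row [j]. *)
Let swap_matrix j i (s : {perm I}) y k : nat := replace j i (s^-1%g k) == y.

Let weight_swap j i s : weight (swap_matrix j i s) = swap_weight j i s.
Proof.
rewrite /weight exchange_big /= /swap_weight.
rewrite (reindex_inj (@perm_inj _ s)) /=; apply: eq_bigr => x _.
rewrite -(prod_indicator (fun y => B y (s x)) (replace j i x)).
by apply: eq_bigr => y _; rewrite /swap_matrix permK.
Qed.

Let swap_col j i s k : (\sum_y swap_matrix j i s y k)%N = 1%N.
Proof. exact: sum_indicator. Qed.

Let swap_row j i s y : (\sum_k swap_matrix j i s y k + (y == i) = 1 + (y == j))%N.
Proof.
rewrite (reindex_inj (@perm_inj _ s)) /= (bigD1 i) //= /swap_matrix permK.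
rewrite /replace eqxx eq_sym.
under eq_bigr => x xi do rewrite permK (negPf xi) eq_sym.
rewrite -(sum_indicator y) [in RHS](bigD1 i) //=.
by rewrite [RHS]addnC -!addnA; congr (_ + _)%N; rewrite addnC.
Qed.

(** Summing replacement matrices along the walk makes the row sums telescope: only an excess at [i]
    and a deficit at [j] remain. *)
Let walk_matrix i j : connect dominates i j ->
  exists r N, [/\ forall k, (\sum_y N y k)%N = r,
    forall y, (\sum_k N y k + (y == j) = r + (y == i))%N & le (P ^+ r) (weight N)].
Proof.
move=> /connectP[p]; elim: p i => [|l p IH] i /=.
  move=> _ ->; exists 0%N, (fun _ _ => 0%N).
  split=> [k|y|]; rewrite ?big1 //.
  rewrite expr0 /weight big1; first exact: le_refl.
  by move=> y _; rewrite big1.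
case/andP=> /and3P[_ _ /asboolP[s les]] lp jE.
have [r [N [colN rowN leN]]] := IH l lp jE.
exists r.+1, (fun y k => swap_matrix i l s y k + N y k)%N; split=> [k|y|].
- by rewrite big_split /= swap_col colN.
- have h1 := swap_row i l s y; have h2 := rowN y.
  rewrite big_split /=; lia.
- by rewrite weightD weight_swap exprS; exact: le_mul.
Qed.

(** Replacing [i] by [j] closes the walk from [i] to [j] into a regular matrix; the walk part weighs
    at least [P ^+ r], which cancels. *)
Let cycle_tight i j s : connect dominates i j ->
  le (swap_weight j i s) P /\
  (le P (swap_weight j i s) ->
   forall x, exists s' : {perm I}, optimal s' /\ s' (replace j i x) = s x).
Proof.
move=> /walk_matrix[r [N [colN rowN leN]]].
have [|le1 tight] := @regular_weight r.+1 (fun y k => swap_matrix j i s y k + N y k)%N.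
  split=> [y|k]; last by rewrite big_split /= swap_col colN.
  have h1 := swap_row j i s y; have h2 := rowN y.
  rewrite big_split /=; lia.
rewrite weightD weight_swap exprS in le1 tight.
have Dw : D (swap_weight j i s) by exact: D_prod.
split=> [|le2 x].
  apply: (@expP_reg r) => //; rewrite [X in le _ X]mulrC.
  apply: le_trans le1; rewrite mulrC; exact: le_mul2l.
apply: tight; first by apply: le_mul => //; exact: D_exp.
by rewrite /swap_matrix permK eqxx.
Qed.

(* The rows of a strongly connected component of [dominates] that no row of [S]
   outside it dominates. Every cycle of replacements is a regular bipartite
   multigraph, hence a union of permutations, so its weight is at most a power
   of [P], with equality only if all its edges lie on optimal permutations. *)
Lemma dominant_rows : S != set0 ->
  exists C : {set I}, [/\ C != set0, C \subset S,
    forall i j s, i \in C -> j \in S -> le (swap_weight j i s) P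
  & forall i j s, i \in C -> j \in S -> optimal s -> le (B i (s i)) (B j (s i)) ->
      j \in C /\ exists s' : {perm I}, optimal s' /\ s' j = s i].
Proof.
case/set0Pn=> i0 Si0.
pose above i := [set j in S | connect dominates j i].
(* A row [m] with the fewest rows above it lies in a top component: any [i] above [m] has the same
   rows above it, among them [m]. *)
case: (@arg_minnP _ i0 (mem S) (fun i => #|above i|)) => //= m Sm mmin.
have top i : i \in above m -> connect dominates m i.
  rewrite inE => /andP[Si cim].
  have sub : above i \subset above m.
    apply/subsetP => j; rewrite !inE => /andP[-> cji] /=.
    exact: connect_trans cji cim.
  have /eqP eq_above : above i == above m by rewrite eqEcard sub; exact: mmin.
  have : m \in above m by rewrite inE Sm connect0.
  by rewrite -eq_above inE => /andP[].
exists (above m).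
have conn i j : i \in above m -> j \in above m -> connect dominates i j.
  by move=> Ci Cj; apply: connect_trans (top _ Cj); move: Ci; rewrite inE => /andP[].
have Cdom i j : i \in above m -> dominates j i -> j \in above m.
  rewrite !inE => /andP[_ cim] dji.
  have /and3P[Sj _ _] := dji.
  by rewrite Sj (connect_trans (connect1 dji)).
split.
- by apply/set0Pn; exists m; rewrite inE Sm connect0.
- by apply/subsetP => j; rewrite inE => /andP[].
- move=> i j s Ci Sj.
  have Dw : D (swap_weight j i s) by exact: D_prod.
  have [//|leP] := le_total Dw DP.
  have Cj : j \in above m.
    apply: (Cdom i) => //; apply/and3P; split=> //; last by apply/asboolP; exists s.
    by move: Ci; rewrite inE => /andP[].
  by case: (cycle_tight s (conn _ _ Ci Cj)).
- move=> i j s Ci Sj opts leij.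
  have leP : le P (swap_weight j i s).
    apply: le_trans opts _; rewrite /swap_weight (bigD1 i) //= [X in le _ X](bigD1 i) //=.
    rewrite /replace eqxx.
    have -> : \prod_(x | x != i) B (if x == i then j else x) (s x) =
              \prod_(x | x != i) B x (s x).
      by apply: eq_bigr => x /negPf->.
    by rewrite ![_ * (\prod_(x | _) _)]mulrC; apply: le_mul2l => //; exact: D_prod.
  have Cj : j \in above m.
    apply: (Cdom i) => //; apply/and3P; split=> //; last by apply/asboolP; exists s.
    by move: Ci; rewrite inE => /andP[].
  have [_ /(_ leP i)] := cycle_tight s (conn _ _ Ci Cj).
  by rewrite /replace eqxx.
Qed.
End OptimalPermutations.

(** * Cancelative meta-tangible triples *)

Section NegationMap.
Variables (A : comPzSemiRingType) (T : A -> Prop) (neg : A -> A).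
Hypothesis hneg : is_negation_map T neg.

Lemma negD x y : neg (x + y) = neg x + neg y.
Proof. by case: hneg. Qed.

Lemma negK : involutive neg.
Proof. by case: hneg. Qed.

Lemma neg_mull x y : neg (x * y) = neg x * y.
Proof. by case: hneg. Qed.

Lemma neg_mulr x y : neg (x * y) = x * neg y.
Proof. by rewrite mulrC neg_mull mulrC. Qed.

Lemma T_neg x : T x -> T (neg x).
Proof. by case: hneg => _ _ _; apply. Qed.

Lemma neg0 : neg 0 = 0.
Proof. by rewrite -[0 in LHS](mul0r 0) neg_mulr mul0r. Qed.

Lemma neg_sum (J : Type) (r : seq J) (Q : pred J) (F : J -> A) :
  neg (\sum_(j <- r | Q j) F j) = \sum_(j <- r | Q j) neg (F j).
Proof. exact: (big_morph neg negD neg0). Qed.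

Lemma circD x y : circ neg (x + y) = circ neg x + circ neg y.
Proof. by rewrite /circ negD; ring. Qed.

Lemma circM u x : circ neg (u * x) = u * circ neg x.
Proof. by rewrite /circ neg_mulr; ring. Qed.

Lemma circ_neg x : circ neg (neg x) = circ neg x.
Proof. by rewrite /circ negK addrC. Qed.

Lemma neg_circ x : neg (circ neg x) = circ neg x.
Proof. by rewrite /circ negD negK addrC. Qed.

Lemma in_circ0 : in_circ neg 0.
Proof. by exists 0; rewrite /circ neg0 addr0. Qed.

Lemma in_circD x y : in_circ neg x -> in_circ neg y -> in_circ neg (x + y).
Proof. by move=> [a ->] [b ->]; exists (a + b); rewrite circD. Qed.

Lemma in_circM u x : in_circ neg x -> in_circ neg (u * x).
Proof. by move=> [a ->]; exists (u * a); rewrite circM. Qed.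

Lemma in_circN x : in_circ neg x -> in_circ neg (neg x).
Proof. by move=> [a ->]; rewrite neg_circ; exists a. Qed.

Lemma in_circ_sum (J : Type) (r : seq J) (Q : pred J) (F : J -> A) :
  (forall j, Q j -> in_circ neg (F j)) -> in_circ neg (\sum_(j <- r | Q j) F j).
Proof. by move=> h; apply: big_ind => //; [exact: in_circ0|exact: in_circD]. Qed.
End NegationMap.

Section Triple.
Variables (A : comPzSemiRingType) (T : A -> Prop) (neg : A -> A).
Hypotheses (T1 : T 1) (T_mul : forall a b, T a -> T b -> T (a * b)) (T0 : ~ T 0).
Hypotheses (hneg : is_negation_map T neg) (htriple : is_T_triple T neg).
Hypotheses (hmeta : meta_tangible T neg) (hcanc : cancelative T).

Let negD := negD hneg.
Let negK := negK hneg.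
Local Notation ci := (circ neg).

Lemma T_not_circ x : T x -> ~ in_circ neg x.
Proof. by case: htriple => h _; exact: h. Qed.

Lemma T_neq_circ t x : T t -> t <> ci x.
Proof. by move=> Tt tx; apply: (T_not_circ Tt); exists x. Qed.

Lemma T_add a b : T a -> T b -> a != neg b -> T (a + b).
Proof.
by move=> Ta Tb /eqP ab; apply: hmeta => // ba; apply: ab; rewrite ba negK.
Qed.

Lemma neg_eq a b : (neg a == neg b) = (a == b).
Proof. exact: inj_eq (inv_inj negK) _ _. Qed.

Lemma eq_neg a b : (a == neg b) = (neg a == b).
Proof. by rewrite -neg_eq negK. Qed.

Lemma neg1_fixed t : T t -> neg t = t -> neg 1 = 1.
Proof. by move=> Tt tE; apply: (hcanc Tt); rewrite -(neg_mulr hneg) mulr1. Qed.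

Lemma neg_id x : neg 1 = 1 -> neg x = x.
Proof. by move=> h; rewrite -{1}[x]mul1r (neg_mull hneg) h mul1r. Qed.

Definition shape x := [\/ x = 0, T x, exists2 t, T t & x = ci t |
  neg 1 = 1 /\ exists t m, T t /\ x = t *+ m].

Let shape_TT u x : T u -> T x -> shape (u + x).
Proof.
move=> Tu Tx; have [->|ux] := eqVneq u (neg x); last by apply: Or42; exact: T_add.
by apply: Or43; exists x => //; rewrite addrC.
Qed.

Let shape_add u x : T u -> shape x -> shape (u + x).
Proof.
move=> Tu [->|Tx|[t Tt ->]|[n1 [t [m [Tt ->]]]]].
- by rewrite addr0; apply: Or42.
- exact: shape_TT.
- have Tnt := T_neg hneg Tt.
  have [ut|ut] := eqVneq u (neg t); last first.
    by rewrite addrA; apply: shape_TT => //; exact: T_add.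
  have [ut'|ut'] := eqVneq u (neg (neg t)); last first.
    by rewrite /circ [t + _]addrC addrA; apply: shape_TT => //; exact: T_add.
  (* Regrouping [u + t + neg t] gives a tangible partial sum unless [u] is both [t] and [neg t].
     Then [neg] is the identity and the sum is [t *+ 3], the reason for the last case of [shape]. *)
  rewrite negK in ut'; have ntt : neg t = t by rewrite -ut.
  apply: Or44; split; first exact: neg1_fixed ntt.
  by exists t, 3; split=> //; rewrite ut' /circ ntt; ring.
- elim: m u Tu => [|m IH] u Tu; first by rewrite mulr0n addr0; apply: Or42.
  have [ut|ut] := eqVneq u (neg t).
    by apply: Or44; split=> //; exists t, m.+2; split=> //; rewrite ut neg_id // -!mulrS.
  by rewrite mulrS addrA; apply: IH; exact: T_add.
Qed.

Lemma shapeP x : shape x.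
Proof.
case: htriple => _ /(_ x)[s [Ts ->]].
elim: s Ts => [|u s IH] Ts; first by rewrite big_nil; apply: Or41.
rewrite big_cons; apply: shape_add; first by apply: Ts; rewrite mem_head.
by apply: IH => t ts; apply: Ts; rewrite inE ts orbT.
Qed.

(** The element [b + ci a] is [(a + b) + neg a], hence tangible. Were it not [b], adding [neg b]
    would again give a tangible element, but the result is [ci (a + b)]. *)
Lemma absorb_of_not_selective a b :
  T a -> T b -> a != neg b -> a + b != a -> a + b != b -> b + ci a = b.
Proof.
move=> Ta Tb ab ca cb; have Tc := T_add Ta Tb ab.
have Td : T (b + ci a).
  have -> : b + ci a = a + b + neg a by rewrite /circ; ring.
  by apply: T_add => //; [exact: (T_neg hneg)|rewrite negK].
have [//|db] := eqVneq (b + ci a) b.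
case: (@T_neq_circ (b + ci a + neg b) (a + b)).
  by apply: T_add => //; [exact: (T_neg hneg)|rewrite negK].
by rewrite (circD hneg) /circ; ring.
Qed.

Lemma absorb_circ_or_selective :
  (forall x, x + ci x = x) \/
  (forall a b, T a -> T b -> a != neg b -> a + b = a \/ a + b = b).
Proof.
have [?|nsel] := pselect (forall a b, T a -> T b -> a != neg b -> a + b = a \/ a + b = b).
  by right.
left; suff [a Ta aE] : exists2 a, T a & a + ci a = a.
  move=> x; have one : 1 + ci 1 = 1.
    by apply: (hcanc Ta); rewrite mulrDr -(circM hneg) mulr1.
  have -> : ci x = x * ci 1 by rewrite -(circM hneg) mulr1.
  by rewrite -{1}[x]mulr1 -mulrDr one mulr1.
apply: contra_notP nsel => nex a b Ta Tb ab.
have [->|ca] := eqVneq (a + b) a; first by left.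
have [->|cb] := eqVneq (a + b) b; first by right.
case: nex; exists a => //.
have baE := absorb_of_not_selective Ta Tb ab ca cb.
have abE : a + ci b = a.
  by apply: absorb_of_not_selective; rewrite // 1?[b + a]addrC // eq_sym -eq_neg.
(* Besides [c = a + b], also [a = c + neg b] and [neg b = neg c + a], all non-selective sums. So [a]
   absorbs both [ci b] and [ci c], whose sum is [ci a]. *)
set c := a + b in ca cb; have Tc : T c := T_add Ta Tb ab.
have Tnb := T_neg hneg Tb; have Tnc := T_neg hneg Tc.
have cbE : c + neg b = a by rewrite -[RHS]abE /c /circ; ring.
have nbcE : neg b + ci c = neg b.
  by apply: absorb_of_not_selective; rewrite ?negK ?cbE // eq_sym.
have acE : a + ci c = a.
  rewrite addrC -[ci c](circ_neg hneg) addrC.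
  have sE : neg c + a = neg b by rewrite -{1}cbE -[RHS]nbcE /circ; ring.
  apply: absorb_of_not_selective; rewrite ?sE //.
  - by rewrite neg_eq.
  - by rewrite neg_eq eq_sym.
  - by rewrite eq_sym.
have naE : neg a = neg c + b by rewrite -cbE negD negK.
have -> : ci a = ci b + ci c by rewrite {1}/circ naE -{1}cbE /circ; ring.
by rewrite addrA abE acE.
Qed.

(* The quasi-order "[s] is at most as large as [t]". In a ring every [s + neg s] is [0]
   and all tangible elements are equivalent, so [0] has to be put below [T] by
   hand in [lvl_le]. *)
Definition tle s t := [\/ s = t, s = neg t | t + ci s = t].

Lemma tle_trans r s t : tle s t -> tle t r -> tle s r.
Proof.
move=> [->|->|st] // tr; last first.
  apply: Or33; case: tr => [<-|tE|tr] //.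
    by apply: (inv_inj negK); rewrite negD (neg_circ hneg) -tE.
  have -> : r + ci s = r + (t + ci s) + neg t by rewrite -{1}tr /circ; ring.
  by rewrite st -addrA.
case: tr => [->|->|tr]; [exact: Or32|by rewrite negK; exact: Or31|].
by apply: Or33; rewrite (circ_neg hneg).
Qed.

Lemma tle_mul u s t : tle s t -> tle (u * s) (u * t).
Proof.
move=> [->|->|st]; first exact: Or31.
- by apply: Or32; rewrite (neg_mulr hneg).
- by apply: Or33; rewrite (circM hneg) -mulrDr st.
Qed.

Lemma tle_cancel u s t : T u -> tle (u * s) (u * t) -> tle s t.
Proof.
move=> Tu [/(hcanc Tu)->||]; first exact: Or31.
- by rewrite (neg_mulr hneg) => /(hcanc Tu)->; exact: Or32.
- by rewrite (circM hneg) -mulrDr => /(hcanc Tu); exact: Or33.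
Qed.

Let tle_of_addl s t : T s -> T t -> t + s = t -> tle s t.
Proof.
move=> Ts Tt ts; have [->|st] := eqVneq s t; first exact: Or31.
apply: Or33; have Tns := T_neg hneg Ts.
have [rt|rt] := eqVneq (t + neg s) t; first by rewrite /circ addrA ts.
have [rs|rs] := eqVneq (t + neg s) (neg s).
  case: (@T_neq_circ t t) => //.
  have sE : neg t + s = s by rewrite -[RHS]negK -rs negD negK.
  by rewrite -[LHS]ts -sE /circ addrCA ts addrC.
rewrite -(circ_neg hneg); apply: absorb_of_not_selective; rewrite 1?addrC //.
by rewrite neg_eq.
Qed.

Lemma tle_total s t : T s -> T t -> tle s t \/ tle t s.
Proof.
move=> Ts Tt; have [->|st] := eqVneq s (neg t); first by left; exact: Or32.
have [cs|cs] := eqVneq (s + t) s; first by right; exact: tle_of_addl.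
have [ct|ct] := eqVneq (s + t) t; first by left; apply: tle_of_addl; rewrite // addrC.
by left; apply: Or33; exact: absorb_of_not_selective.
Qed.

Definition lvl_le x y := x = 0 \/ [/\ T x, T y & tle x y].

Definition T_or_0 x := T x \/ x = 0.

Lemma T_or_0_mul x y : T_or_0 x -> T_or_0 y -> T_or_0 (x * y).
Proof.
move=> [Tx|->]; last by right; rewrite mul0r.
move=> [Ty|->]; last by right; rewrite mulr0.
by left; exact: T_mul.
Qed.

Lemma lvl_refl x : T_or_0 x -> lvl_le x x.
Proof. by move=> [Tx|->]; [right; split=> //; exact: Or31|left]. Qed.

Lemma lvl_trans x y z : lvl_le x y -> lvl_le y z -> lvl_le x z.
Proof.
move=> [->|[Tx Ty xy]]; first by left.
move=> [y0|[_ Tz yz]]; first by case: T0; rewrite -y0.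
by right; split=> //; exact: tle_trans yz.
Qed.

Lemma lvl_total x y : T_or_0 x -> T_or_0 y -> lvl_le x y \/ lvl_le y x.
Proof.
move=> [Tx|->]; last by left; left.
move=> [Ty|->]; last by right; left.
by have [xy|yx] := tle_total Tx Ty; [left|right]; right.
Qed.

Lemma lvl_mul2l u x y : T_or_0 u -> lvl_le x y -> lvl_le (u * x) (u * y).
Proof.
move=> [Tu|->]; last by left; rewrite mul0r.
move=> [->|[Tx Ty xy]]; first by left; rewrite mulr0.
by right; split; [exact: T_mul|exact: T_mul|exact: tle_mul].
Qed.

Lemma lvl_cancel u x y :
  T u -> T_or_0 x -> T_or_0 y -> lvl_le (u * x) (u * y) -> lvl_le x y.
Proof.
move=> Tu [Tx|->]; last by left.
move=> [Ty|->] [ux0|[_ Tuy xy]].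
- by case: T0; rewrite -ux0; exact: T_mul.
- by right; split=> //; exact: tle_cancel xy.
- by case: T0; rewrite -ux0; exact: T_mul.
- by case: T0; rewrite -(mulr0 u).
Qed.

Section Selective.
Hypothesis sel : forall a b, T a -> T b -> a != neg b -> a + b = a \/ a + b = b.

Lemma sel_antisym s t : T s -> T t -> tle s t -> tle t s -> s = t \/ s = neg t.
Proof.
move=> Ts Tt [->|->|st]; [by left|by right|].
move=> [->|->|ts]; [by left|by rewrite negK; right|].
have [->|snt] := eqVneq s (neg t); first by right.
case: (sel Ts Tt snt) => h.
- case: (@T_neq_circ t s) => //.
  by rewrite -{1}st /circ addrA [t + s]addrC h.
- case: (@T_neq_circ s t) => //.
  by rewrite -{1}ts /circ addrA h.
Qed.

Lemma sel_absorb x r : T x -> T r -> tle x r -> x != r -> x != neg r -> r + x = r.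
Proof.
move=> Tx Tr [->|->|xr]; rewrite ?eqxx // => _ xnr.
have rnx : r != neg x by rewrite eq_sym -eq_neg.
case: (sel Tr Tx rnx) => // h.
case: (@T_neq_circ r x) => //.
by rewrite -{1}xr /circ addrA h.
Qed.
End Selective.

Lemma in_circ_even x k : neg 1 = 1 -> in_circ neg (x *+ k.*2).
Proof. by move=> n1; exists (x *+ k); rewrite /circ neg_id // -mulrnDr addnn. Qed.

(** The hard case is [x = t *+ m] with [m] odd and [neg] trivial. If quasi-zeros are absorbed, [x]
    is [t] and [u * x] is tangible. Otherwise [u * x] is an even multiple of a tangible [s], and
    comparing [u * t] with [s] makes [x] an even multiple of [t] or the tangible [u * t] a
    quasi-zero. *)
Lemma circ_cancel u x : T u -> in_circ neg (u * x) -> in_circ neg x.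
Proof.
move=> Tu ux; case: (shapeP x) => [->|Tx|[t _ ->]|[n1 [t [m [Tt xE]]]]].
- exact: (in_circ0 hneg).
- by case: (T_not_circ (T_mul Tu Tx)).
- by exists t.
have Tut := T_mul Tu Tt.
have [modd|] := boolP (odd m); last first.
  by move=> me; rewrite xE -(odd_double_half m) (negPf me); exact: in_circ_even.
case: absorb_circ_or_selective => [abs|sel].
  have {}xE : x = t.
    rewrite xE -(odd_double_half m) modd; elim: m./2 => // k IH.
    rewrite doubleS !addnS 2!mulrSr IH.
    by have := abs t; rewrite /circ neg_id // addrA.
  by case: (T_not_circ Tut); rewrite -xE.
have [s [k [Ts sE]]] : exists s k, T s /\ u * x = s *+ k.*2.
  case: ux => y ->; rewrite /circ neg_id //.
  case: (shapeP y) => [->|Ty|[s Ts ->]|[_ [s [k [Ts ->]]]]].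
  - by exists 1, 0%N; rewrite addr0.
  - by exists y, 1%N.
  - by exists s, 2; split=> //; rewrite /circ neg_id // -!mulr2n -mulrnA.
  - by exists s, k; rewrite -mulrnDr addnn.
have utE : (u * t) *+ m = s *+ k.*2 by rewrite -sE xE mulrnAr.
have absorb_mul (a b : A) j : a + b = a -> a + b *+ j = a.
  by move=> ab; elim: j => [|j IH]; rewrite ?addr0 // mulrSr addrA IH.
have evenS : m.+1 = (m.+1)./2.*2 by lia.
have [st|st] := eqVneq (u * t) s.
  have -> : x = t *+ k.*2 by apply: (hcanc Tu); rewrite sE mulrnAr st.
  exact: in_circ_even.
case: k => [|k] in sE utE *.
  by have -> : x = 0 by [apply: (hcanc Tu); rewrite sE mulr0]; exact: (in_circ0 hneg).
have stn : u * t != neg s by rewrite neg_id.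
case: (sel _ _ Tut Ts stn) => h.
- case: (T_not_circ Tut).
  rewrite -(absorb_mul _ _ k.+1.*2 h) -utE -mulrS evenS; exact: in_circ_even.
- have -> : x = t *+ m.+1.
    apply: (hcanc Tu); rewrite sE mulrnAr [in RHS]mulrSr utE.
    by rewrite doubleS [in RHS]mulrSr -addrA [s + _]addrC h -mulrSr.
  rewrite evenS; exact: in_circ_even.
Qed.
End Triple.

(** * Determinants *)

Lemma maximum_exists (J : finType) (X : Type) (D : X -> Prop) (le : X -> X -> Prop)
    (F : J -> X) (j0 : J) :
  (forall x, D x -> le x x) -> (forall x y z, le x y -> le y z -> le x z) ->
  (forall x y, D x -> D y -> le x y \/ le y x) -> (forall j, D (F j)) ->
  exists m, forall j, le (F j) (F m).
Proof.
move=> refl trans total DF.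
suff [m hm] : exists m, forall j, j \in enum J -> le (F j) (F m).
  by exists m => j; apply: hm; rewrite mem_enum.
elim: (enum J) => [|a s [m hm]]; first by exists j0.
have [am|ma] := total _ _ (DF a) (DF m).
  by exists m => j; rewrite inE => /orP[/eqP->|/hm].
exists a => j; rewrite inE => /orP[/eqP->|/hm jm]; first exact: refl.
exact: trans ma.
Qed.

Lemma sum_perm_swap (I : finType) (V : nmodType) (F : {perm I} -> V) (i j : I) :
  i != j ->
  \sum_s F s = \sum_(s | ~~ odd_perm s) (F s + F (tperm i j * s)%g).
Proof.
move=> ij; rewrite big_split /= (bigID (fun s => ~~ odd_perm s)) /=; congr (_ + _).
rewrite (reindex_inj (mulgI (tperm i j))) /=; apply: eq_bigl => s.
by rewrite odd_permM odd_tperm ij negbK.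
Qed.

(** Row [j] fills both slots [i] and [j], so exchanging them changes nothing. With [sum_perm_swap]
    this pairs the terms of a determinant with a repeated row. *)
Lemma swap_weight_tperm (I : finType) (A : comPzSemiRingType) (B : I -> I -> A)
    (i j : I) (s : {perm I}) :
  swap_weight B j i (tperm i j * s)%g = swap_weight B j i s.
Proof.
rewrite /swap_weight (reindex_inj (@perm_inj _ (tperm i j))) /=.
apply: eq_bigr => x _; rewrite permM tpermK; congr (B _ _); rewrite /replace.
by case: tpermP => [->|->|/eqP/negPf-> _]; rewrite ?eqxx // ; case: eqP.
Qed.

Lemma swap_weightE (I : finType) (A : comPzSemiRingType) (B : I -> I -> A)
    (i j : I) (s : {perm I}) :
  swap_weight B j i s = (\prod_(x | x != i) B x (s x)) * B j (s i).
Proof.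
rewrite /swap_weight (bigD1 i) //= mulrC /replace eqxx; congr (_ * _).
by apply: eq_bigr => x /negPf->.
Qed.

Lemma swap_weight_id (I : finType) (A : comPzSemiRingType) (B : I -> I -> A)
    (i : I) (s : {perm I}) :
  swap_weight B i i s = \prod_x B x (s x).
Proof. by rewrite swap_weightE [RHS](bigD1 i) //= mulrC. Qed.

(** * Signed sums over permutations *)

Section SignedSums.
Variables (A : comPzSemiRingType) (T : A -> Prop) (neg : A -> A).
Hypothesis hneg : is_negation_map T neg.
Variable n : nat.
Implicit Type s : 'S_n.

Lemma neg_sign_mull s x y : neg_sign neg s (x * y) = neg_sign neg s x * y.
Proof. by rewrite /neg_sign; case: ifP => // _; rewrite (neg_mull hneg). Qed.

Lemma neg_sign_sum s (J : finType) (Q : pred J) (F : J -> A) :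
  neg_sign neg s (\sum_(j | Q j) F j) = \sum_(j | Q j) neg_sign neg s (F j).
Proof. by rewrite /neg_sign; case: ifP => // _; rewrite (neg_sum hneg). Qed.

Lemma neg_sign_tperm (i j : 'I_n) s x :
  i != j -> neg_sign neg (tperm i j * s)%g x = neg (neg_sign neg s x).
Proof.
move=> ij; rewrite /neg_sign odd_permM odd_tperm ij /=.
by case: (odd_perm s) => //=; rewrite (negK hneg).
Qed.

Lemma in_circ_neg_sign s x : in_circ neg x -> in_circ neg (neg_sign neg s x).
Proof. by rewrite /neg_sign; case: ifP => // _; exact: (in_circN hneg). Qed.

(* The transfer of linear dependence to a ring [R]: [phi] is only odd, not
   additive, and expanding along row [i] needs no more. *)
Lemma weighted_signed_sum_eq0 (R : comNzRingType) (phi : A -> R)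
    (B : 'I_n -> 'I_n -> A) (C : {set 'I_n}) (mag : 'I_n -> 'I_n -> R) (i : 'I_n) :
  (forall x, phi (neg x) = - phi x) -> i \in C ->
  (forall k y, \sum_(j in C) mag j k * phi (y * B j k) = 0) ->
  \sum_(s : 'S_n) phi (neg_sign neg s (\prod_x B x (s x))) *
    \prod_(x in C) mag x (s x) = 0.
Proof.
(* Extending [mag] by 1 outside [C] makes the product run over all rows, so that row [i] can be
   replaced in [B] and in the magnitudes at once. *)
move=> phiN Ci col; pose mag1 x k := if x \in C then mag x k else 1.
pose G j s := phi (neg_sign neg s (swap_weight B j i s)) * swap_weight mag1 j i s.
have sumG : \sum_(j in C) \sum_s G j s = 0.
  rewrite exchange_big big1 //= => s _.
  have := col (s i) (neg_sign neg s (\prod_(x | x != i) B x (s x))).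
  move/(congr1 ( *%R (\prod_(x | x != i) mag1 x (s x)))).
  rewrite mulr0 mulr_sumr; apply: etrans; apply: eq_bigr => j Cj.
  rewrite /G !swap_weightE neg_sign_mull /mag1 Cj.
  by rewrite mulrC -mulrA.
have swapG j : j \in C -> j != i -> \sum_s G j s = 0.
  move=> Cj ji; rewrite eq_sym in ji.
  rewrite (sum_perm_swap _ ji) big1 // => s _.
  by rewrite /G !swap_weight_tperm neg_sign_tperm // phiN mulNr subrr.
rewrite (bigD1 i) //= [X in _ + X]big1 ?addr0 in sumG; last first.
  by move=> j /andP[Cj ji]; exact: swapG.
rewrite -[RHS]sumG; apply: eq_bigr => s _.
by rewrite /G !swap_weight_id [in RHS]/mag1 -big_mkcond.
Qed.
End SignedSums.

(** * Determinants of matrices with quasi-zero column sums over [S] *)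

Section Determinant.
Variables (A : comPzSemiRingType) (T : A -> Prop) (neg : A -> A).
Hypotheses (T1 : T 1) (T_mul : forall a b, T a -> T b -> T (a * b)) (T0 : ~ T 0).
Hypotheses (hneg : is_negation_map T neg) (htriple : is_T_triple T neg).
Hypotheses (hmeta : meta_tangible T neg) (hcanc : cancelative T).
Variables (n : nat) (B : 'I_n -> 'I_n -> A) (S C : {set 'I_n}).
Hypothesis TB : forall j k, T_or_0 T (B j k).
Hypothesis colS : forall k, in_circ neg (\sum_(j in S) B j k).

Local Notation ci := (circ neg).
Local Notation le := (lvl_le T neg).
Let term (s : 'S_n) := \prod_x B x (s x).
Let signed (s : 'S_n) := neg_sign neg s (term s).

Variable s0 : 'S_n.
Let P := term s0.
Hypothesis TP : T P.
Hypothesis P_max : forall s, le (term s) P.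

Variable i0 : 'I_n.
Hypothesis Ci0 : i0 \in C.
Hypothesis CS : C \subset S.
Hypothesis swap_le : forall i j s, i \in C -> j \in S -> le (swap_weight B j i s) P.
Hypothesis C_closed : forall i j s, i \in C -> j \in S -> optimal le B P s ->
  le (B i (s i)) (B j (s i)) ->
  j \in C /\ exists s' : 'S_n, optimal le B P s' /\ s' j = s i.

Let T_or_0_prod (Q : pred 'I_n) (F : 'I_n -> A) :
  (forall j, T_or_0 T (F j)) -> T_or_0 T (\prod_(j | Q j) F j).
Proof.
by move=> TF; apply: big_ind => [|x y|j _] //; [left|exact: T_or_0_mul].
Qed.

Let T_optimal s : optimal le B P s -> T (term s).
Proof. by case=> [P0|[]//]; case: T0; rewrite -P0. Qed.

(** The replaced product is at most [P], hence at most the product along the optimal [s]. They share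
    all factors outside row [i], which are tangible and cancel. *)
Let top_entry i j s : i \in C -> j \in S -> optimal le B P s ->
  le (B j (s i)) (B i (s i)) /\ T (B i (s i)).
Proof.
move=> Ci Sj opts; have := T_optimal opts.
have := lvl_trans T0 hneg (swap_le s Ci Sj) opts.
rewrite /term -(swap_weight_id B i) !swap_weightE => cmp Tt.
have TR : T (\prod_(x | x != i) B x (s x)).
  case: (T_or_0_prod (fun x => x != i) (fun x => TB x (s x))) => // R0.
  by case: T0; rewrite -[0](mul0r (B i (s i))) -R0.
split; first exact: (lvl_cancel T_mul T0 hneg hcanc TR).
by case: (TB i (s i)) => // Bi0; case: T0; rewrite Bi0 mulr0 in Tt.
Qed.

Let signed_cases s : signed s = term s \/ signed s = neg (term s).
Proof. by rewrite /signed /neg_sign; case: ifP; [right|left]. Qed.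

Let add_absorb (a : A) (J : finType) (Q : pred J) (F : J -> A) :
  (forall j, Q j -> a + F j = a) -> a + \sum_(j | Q j) F j = a.
Proof.
move=> h; apply: (big_ind (fun x => a + x = a)) => // [|x y ax ay]; first exact: addr0.
by rewrite addrA ax.
Qed.

Lemma det_in_circ_absorbing :
  (forall x, x + ci x = x) -> in_circ neg (\sum_s signed s).
Proof.
move=> abs; set d := \sum_s signed s.
(* [Delta j] is the determinant with row [i0] replaced by row [j]. For [j != i0] the repeated row
   makes it a sum of quasi-zeros [ci v] with [v] at most [P], and [d] absorbs these because its term
   at [s0] absorbs [ci P]. *)
pose Delta j := \sum_s neg_sign neg s (swap_weight B j i0 s).
have Si0 : i0 \in S := subsetP CS _ Ci0.
have sumD : in_circ neg (\sum_(j in S) Delta j).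
  rewrite exchange_big; apply: (in_circ_sum hneg) => s _.
  rewrite -(neg_sign_sum hneg); apply: (in_circ_neg_sign hneg).
  under eq_bigr do rewrite swap_weightE.
  by rewrite -mulr_sumr; apply: (in_circM hneg).
have dP : d + ci P = d.
  rewrite /d (bigD1 s0) //= addrAC; congr (_ + _).
  by case: (signed_cases s0) => ->; last rewrite -(circ_neg hneg); exact: abs.
have dv v : le v P -> d + ci v = d.
  move=> [->|[_ _ [->|->|Pv]]]; rewrite ?(circ_neg hneg) //.
    by rewrite /circ (neg0 hneg) !addr0.
  rewrite -{1}dP.
  have -> : d + ci P + ci v = d + (P + ci v) + neg P by rewrite /circ; ring.
  by rewrite Pv -addrA.
move: sumD; rewrite (bigD1 i0) //=.
have -> : Delta i0 = d by apply: eq_bigr => s _; rewrite swap_weight_id.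
rewrite add_absorb // => j /andP[Sj ji]; rewrite eq_sym in ji.
rewrite /Delta (sum_perm_swap _ ji) add_absorb // => s evs.
rewrite swap_weight_tperm (neg_sign_tperm hneg) //.
by rewrite /neg_sign (negPf evs) dv //; exact: swap_le.
Qed.

Section Selective.
Hypothesis sel : forall a b, T a -> T b -> a != neg b -> a + b = a \/ a + b = b.

(* The entries in the rows of [C] that lie on an optimal permutation. In each
   column they are exactly the largest entries among the rows of [S]. *)
Let E j k := (j \in C) && `[< exists s, optimal le B P s /\ s j = k >].

(** If some term is [neg tau], the sum is [ci tau], which absorbs the other terms. If none were,
    [phi] would yield a vanishing sum of nonnegative integers with a positive term at [s0]. *)
Lemma det_in_circ_signed : neg 1 <> 1 -> in_circ neg (\sum_s signed s).
Proof.
move=> n1.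
have neq_neg t : T t -> t != neg t.
  by move=> Tt; apply/eqP => h; apply: n1; apply: (neg1_fixed hneg hcanc Tt).
have idem t : T t -> t + t = t by move=> Tt; case: (sel Tt Tt (neq_neg t Tt)).
set tau := signed s0.
have Ttau : T tau.
  by rewrite /tau; case: (signed_cases s0) => ->; rewrite // ; exact: (T_neg hneg).
have le_tau s : signed s = 0 \/ T (signed s) /\ tle neg (signed s) tau.
  case: (P_max s) => [t0|[Tt _ tP]].
    by left; case: (signed_cases s) => ->; rewrite t0 ?(neg0 hneg).
  right; have h1 : tle neg (signed s) (term s).
    by case: (signed_cases s) => ->; [exact: Or31|exact: Or32].
  have h2 : tle neg P tau.
    rewrite /tau; case: (signed_cases s0) => ->; first exact: Or31.
    by apply: Or32; rewrite (negK hneg).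
  split; last exact: (tle_trans hneg) (tle_trans hneg h1 tP) h2.
  by case: (signed_cases s) => ->; rewrite // ; exact: (T_neg hneg).
have [/existsP[s1 /eqP s1E]|nex] := boolP [exists s, signed s == neg tau].
  exists tau; rewrite (bigD1 s0) //= (bigD1 s1) /=; last first.
    by apply: contra_neqN (neq_neg _ Ttau) => /eqP s10; rewrite -s1E s10.
  rewrite s1E addrA -/(ci tau); apply: add_absorb => s _.
  case: (le_tau s) => [->|[Ts sle]]; first by rewrite addr0.
  have [->|sn] := eqVneq (signed s) tau; first by rewrite /circ addrAC idem.
  have [->|sn'] := eqVneq (signed s) (neg tau).
    by rewrite /circ -addrA idem //; exact: (T_neg hneg).
  by rewrite /circ addrAC (sel_absorb hneg htriple sel Ts Ttau sle).
exfalso; move: nex; rewrite negb_exists => /forallP nex.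
pose phi (x : A) : int := (x == tau)%:R - (x == neg tau)%:R.
have phiN x : phi (neg x) = - phi x.
  by rewrite /phi opprB (neg_eq hneg) -(eq_neg hneg).
(* Weighting each entry by the number of entries of opposite sign in its column
   makes every column sum to zero. *)
pose opp j j' k := [&& E j k, E j' k & B j' k == neg (B j k)].
have oppC j j' k : opp j j' k = opp j' j k.
  by rewrite /opp andbCA (eq_neg hneg) [neg _ == _]eq_sym.
pose mag j k : int := \sum_(j' in C) (opp j j' k)%:R.
have col k y : \sum_(j in C) mag j k * phi (y * B j k) = 0.
  set X := \sum_(j in C) _.
  have XN : X = - X.
    rewrite {1}/X /mag; under eq_bigr do rewrite mulr_suml.
    rewrite exchange_big -sumrN; apply: eq_bigr => j Cj /=.
    rewrite mulr_suml -sumrN; apply: eq_bigr => j' Cj'; rewrite oppC.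
    case: (boolP (opp j j' k)) => [/and3P[_ _ /eqP ->]|_]; last by rewrite !mul0r oppr0.
    by rewrite -(neg_mulr hneg) phiN mulrN.
  lia.
have := weighted_signed_sum_eq0 hneg phiN Ci0 col.
have term_ge0 s : 0 <= phi (neg_sign neg s (term s)) * \prod_(x in C) mag x (s x).
  apply: Num.Theory.mulr_ge0.
    by rewrite /phi -/(signed s) (negPf (nex s)) subr0 Num.Theory.ler0n.
  by apply: Num.Theory.prodr_ge0 => x _; apply: Num.Theory.sumr_ge0 => j _;
    exact: Num.Theory.ler0n.
move=> /(Num.Theory.psumr_eq0P (fun s _ => term_ge0 s))/(_ s0 isT)/eqP.
rewrite mulf_eq0 /phi -/(signed s0) -/tau eqxx (negPf (neq_neg _ Ttau)) subr0 oner_eq0 /=.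
apply/negP; rewrite prodf_seq_neq0; apply/allP => x _; apply/implyP => Cx.
have opt0 : optimal le B P s0 by apply: lvl_refl; left.
have Sx := subsetP CS _ Cx.
have [_ TBx] := top_entry Cx Sx opt0.
(* Without an entry opposite to the top one, the sum of this column over [S] would be that tangible
   entry and not a quasi-zero. *)
have [/existsP[j /andP[Sj /eqP jE]]|nj] :=
    boolP [exists j, (j \in S) && (B j (s0 x) == neg (B x (s0 x)))].
  have [Cj [s' [opts' s'j]]] : j \in C /\ exists s', optimal le B P s' /\ s' j = s0 x.
    apply: C_closed => //; right; split=> //; rewrite jE; first exact: (T_neg hneg).
    by apply: Or32; rewrite (negK hneg).
  rewrite Num.Theory.psumr_neq0 => [|j' _]; last exact: Num.Theory.ler0n.
  apply/hasP; exists j; first exact: mem_index_enum.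
  rewrite Cj /= /opp jE eqxx andbT /E Cx Cj /= Num.Theory.ltr0n lt0b.
  by apply/andP; split; apply/asboolP; [exists s0|exists s'].
case: (T_not_circ htriple TBx).
suff <- : \sum_(j in S) B j (s0 x) = B x (s0 x) by exact: colS.
rewrite (bigD1 x) //= add_absorb // => j /andP[Sj _].
have [[->|[TBj _ jle]] _] := top_entry Cx Sj opt0; first exact: addr0.
have [->|jn] := eqVneq (B j (s0 x)) (B x (s0 x)); first exact: idem.
apply: (sel_absorb hneg htriple sel) => //; apply: contraNneq nj => jE.
by apply/existsP; exists j; rewrite Sj jE eqxx.
Qed.
(** One copy of [r] is present, at [j0], and it absorbs every summand different from [r]. *)
Let sum_top_count (J : finType) (Q : pred J) (F : J -> A) (r : A) (j0 : J) :
  neg 1 = 1 -> (forall j, Q j -> le (F j) r) -> T r -> Q j0 -> F j0 = r ->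
  \sum_(j | Q j) F j = r *+ #|[pred j | Q j && (F j == r)]|.
Proof.
move=> n1 Fle Tr Qj0 Fj0; rewrite (bigID (fun j => F j == r)) /=.
have -> : \sum_(j | Q j && (F j == r)) F j = r *+ #|[pred j | Q j && (F j == r)]|.
  by rewrite -sumr_const; apply: eq_bigr => j /andP[_ /eqP].
have : (0 < #|[pred j | Q j && (F j == r)]|)%N.
  by apply/card_gt0P; exists j0; rewrite inE Qj0 Fj0 eqxx.
case: #|_| => // c _; apply: add_absorb => j /andP[Qj Fjr].
rewrite mulrSr -addrA; congr (_ + _).
case: (Fle j Qj) => [->|[TFj _ Fjle]]; first exact: addr0.
by apply: (sel_absorb hneg htriple sel) => //; rewrite (neg_id hneg _ n1).
Qed.

Lemma det_in_circ_unsigned : neg 1 = 1 -> in_circ neg (\sum_s signed s).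
Proof.
move=> n1.
have antisym x y : le x y -> le y x -> x = y.
  move=> [->|[Tx Ty xy]] [y0|[_ _ yx]] //.
    by case: T0; rewrite -y0.
  by case: (sel_antisym hneg htriple sel Tx Ty xy yx); rewrite // (neg_id hneg _ n1).
have signedE s : signed s = term s.
  by case: (signed_cases s) => ->; rewrite ?(neg_id hneg _ n1).
have optE s : optimal le B P s <-> term s = P.
  split=> [opts|tP]; last by rewrite /optimal -/(term s) tP; apply: lvl_refl; left.
  exact: antisym.
set N := #|[pred s | true && (term s == P)]|.
have detE : \sum_s signed s = P *+ N.
  under eq_bigr do rewrite signedE.
  exact: (@sum_top_count _ xpredT term P s0).
pose c k := #|[pred j | E j k]|.
have col_eq j j' k : E j k -> j' \in S -> le (B j k) (B j' k) -> E j' k /\ B j' k = B j k.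
  move=> /andP[Cj /asboolP[s [opts <-]]] Sj' jle.
  have [Cj' [s' [opts' s'j']]] := C_closed Cj Sj' opts jle.
  split; first by rewrite /E Cj'; apply/asboolP; exists s'.
  by apply: antisym => //; case: (top_entry Cj Sj' opts).
have ES j k : E j k -> j \in S by case/andP => /(subsetP CS).
have E_le j j' k : E j k -> j' \in S -> le (B j' k) (B j k).
  by move=> /andP[Cj /asboolP[s [opts <-]]] Sj'; case: (top_entry Cj Sj' opts).
have E_eq j j' k : E j k -> E j' k -> B j' k = B j k.
  move=> Ej Ej'; apply: antisym; first exact: E_le Ej (ES _ _ Ej').
  exact: E_le Ej' (ES _ _ Ej).
(* If the number of top entries is even in every column, so is [N], by the
   determinant modulo 2. If it is odd in column [k], then [c k] copies of [1] form
   a quasi-zero, and [N] exceeds [c k] by an even number or is even. *)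
have [even_c|] := boolP [forall k, ~~ odd (c k)].
  suff oddN : ~~ odd N.
    by rewrite detE -(odd_double_half N) (negPf oddN); exact: (in_circ_even hneg).
  pose phi (x : A) : 'F_2 := (x == P)%:R.
  have phiN x : phi (neg x) = - phi x.
    by rewrite (neg_id hneg _ n1) // /phi; case: eqP => _; apply/val_inj.
  (* All top entries of a column coincide, so the sum is the even number [c k] times a single value
     of [phi]. *)
  have colF k y : \sum_(j in C) (E j k)%:R * phi (y * B j k) = 0.
    have [/existsP[j0 Ej0]|/existsPn nE] := boolP [exists j, E j k]; last first.
      by apply: big1 => j _; rewrite (negPf (nE j)) mul0r.
    have -> : \sum_(j in C) (E j k)%:R * phi (y * B j k) =
              \sum_(j in C) (E j k)%:R * phi (y * B j0 k).
      apply: eq_bigr => j _; case: (boolP (E j k)) => Ej; last by rewrite !mul0r.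
      by rewrite (E_eq j0 j).
    rewrite -mulr_suml -natr_sum.
    have -> : (\sum_(j in C) E j k = c k)%N.
      rewrite /c -sum1_card [RHS]big_mkcond [LHS]big_mkcond /=; apply: eq_bigr => j _.
      by rewrite inE /E; case: (j \in C) => //=; case: `[< _ >].
    have := forallP even_c k; rewrite -(odd_double_half (c k)) => /negPf.
    rewrite oddD odd_double addbF oddb => ->.
    by rewrite -muln2 natrM (_ : 2%:R = 0 :> 'F_2) ?mulr0 ?mul0r //; apply/val_inj.
  have := weighted_signed_sum_eq0 hneg phiN Ci0 colF.
  have -> : \sum_(s : 'S_n) phi (neg_sign neg s (\prod_x B x (s x))) *
      \prod_(x in C) (E x (s x))%:R = N%:R.
    rewrite /N -sum1_card natr_sum [RHS]big_mkcond; apply: eq_bigr => s _ /=.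
    rewrite -/(signed s) signedE inE /= /phi; case: eqP => [tP|_]; last by rewrite mul0r.
    rewrite mul1r big1 // => x Cx; rewrite /E Cx /=.
    suff -> : `[< exists s', optimal le B P s' /\ s' x = s x >] by [].
    by apply/asboolP; exists s; split=> //; apply/optE.
  by move=> N0; rewrite -dvdn2 (dvdn_pcharf (pchar_Fp (isT : prime 2))) N0.
rewrite negb_forall => /existsP[k]; rewrite negbK => odd_c.
have [j0 Ej0] : exists j0, E j0 k.
  have /card_gt0P[j0 j0E] : (0 < c k)%N by case: (c k) odd_c.
  by exists j0.
have Sj0 := ES _ _ Ej0.
have TB0 : T (B j0 k).
  case/andP: (Ej0) => Cj0 /asboolP[s [opts <-]].
  by case: (top_entry Cj0 Sj0 opts).
(* Each top entry of column [k] lies on an optimal permutation, and a permutation meets column [k]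
   in one row only. *)
have cN : (c k <= N)%N.
  pose row_of (s : 'S_n) := (s^-1)%g k.
  apply: leq_trans (leq_image_card row_of _); apply: subset_leq_card.
  apply/subsetP => j; rewrite inE => /andP[_ /asboolP[s [opts sj]]].
  apply/imageP; exists s; first by rewrite inE; apply/eqP/optE.
  by rewrite /row_of -sj permK.
have one_c : in_circ neg (1 *+ c k).
  apply: (circ_cancel T1 T_mul hneg htriple hmeta hcanc TB0).
  rewrite mulrnAr mulr1.
  suff <- : \sum_(j in S) B j k = B j0 k *+ c k by exact: colS.
  rewrite (@sum_top_count _ (mem S) (B^~ k) (B j0 k) j0) //; last by move=> j; exact: E_le.
  congr (_ *+ _); apply: eq_card => j; rewrite !inE.
  apply/andP/idP => [[Sj /eqP jE]|Ej].
    by case: (col_eq j0 j k) => //; rewrite jE; apply: lvl_refl; left.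
  by split; [exact: ES Ej|apply/eqP; exact: E_eq].
rewrite detE; have [oddN|evenN] := boolP (odd N); last first.
  by rewrite -(odd_double_half N) (negPf evenN); exact: (in_circ_even hneg).
rewrite -(subnKC cN) mulrnDr; apply: (in_circD hneg).
  by rewrite -[P]mulr1 -mulrnAr; exact: (in_circM hneg).
have -> : (N - c k = (N - c k)./2.*2)%N.
  by have := odd_double_half (N - c k); rewrite oddB // oddN odd_c.
exact: (in_circ_even hneg).
Qed.
End Selective.
End Determinant.

Unset Implicit Arguments.

Theorem theorem9p4 (A : comPzSemiRingType) (T : A -> Prop) (neg : A -> A)
  (hT1 : T 1) (hTmul : forall a b, T a -> T b -> T (a * b)) (hT0 : ~ T 0)
  (hneg : is_negation_map T neg) (htriple : is_T_triple T neg)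
  (hmeta : meta_tangible T neg) (hcanc : cancelative T)
  (n : nat) (M : 'M[A]_n) (hM : forall i j, T (M i j) \/ M i j = 0)
  (hdep : rows_circ_dependent T neg M) :
  in_circ neg (neg_det neg M).
Proof.
case: hdep => S [alpha [S0 Talpha colS]].
(* Rows outside [S] are scaled by 1; the determinant is thus multiplied by a tangible product, which
   [circ_cancel] removes. *)
pose beta j := if j \in S then alpha j else 1.
have Tbeta j : T (beta j) by rewrite /beta; case: ifP => // /Talpha.
pose B j k := beta j * M j k.
have TB j k : T_or_0 T (B j k) by apply: T_or_0_mul (hM j k) => //; left.
have Tprod : T (\prod_j beta j) by apply: big_ind => // j _.
apply: (circ_cancel hT1 hTmul hneg htriple hmeta hcanc Tprod).
have -> : (\prod_j beta j) * neg_det neg M = \sum_s neg_sign neg s (\prod_x B x (s x)).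
  rewrite mulr_sumr; apply: eq_bigr => s _.
  by rewrite mulrC -(neg_sign_mull hneg) mulrC -big_split.
have {}colS k : in_circ neg (\sum_(j in S) B j k).
  suff -> : \sum_(j in S) B j k = \sum_(j in S) alpha j * M j k by [].
  by apply: eq_bigr => j Sj; rewrite /B /beta Sj.
pose term (s : 'S_n) := \prod_x B x (s x).
have Tterm s : T_or_0 T (term s).
  by apply: big_ind => [|x y|j _] //; [left|exact: T_or_0_mul].
have [s0 s0max] := maximum_exists 1%g (@lvl_refl _ T neg) (@lvl_trans _ _ _ hT0 hneg)
  (@lvl_total _ _ _ hneg htriple hmeta) Tterm.
case: (Tterm s0) => [TP|P0]; last first.
  apply: (in_circ_sum hneg) => s _; apply: (in_circ_neg_sign hneg).
  have -> : \prod_x B x (s x) = 0.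
    by case: (s0max s) => [//|[_ TP _]]; case: hT0; rewrite -P0.
  exact: (in_circ0 hneg).
have [|||C [C0 CS swap_le C_closed]] := dominant_rows _ (@T_or_0_mul _ _ hTmul)
  (@lvl_refl _ T neg) (@lvl_trans _ _ _ hT0 hneg) (@lvl_total _ _ _ hneg htriple hmeta)
  (@lvl_mul2l _ _ _ hTmul hneg) TB _ _ s0max S0.
- by left.
- by left.
- by move=> x y; exact: (lvl_cancel hTmul hT0 hneg hcanc TP).
have [i0 Ci0] := set0Pn _ C0.
case: (absorb_circ_or_selective hneg htriple hmeta hcanc) => [abs|sel].
  exact: (det_in_circ_absorbing hneg colS Ci0 CS swap_le abs).
have [n1|n1] := eqVneq (neg 1) 1.
  exact: (det_in_circ_unsigned hT1 hTmul hT0 hneg htriple hmeta hcanc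
    TB colS TP s0max Ci0 CS swap_le C_closed sel n1).
apply: (det_in_circ_signed hT1 hTmul hT0 hneg htriple hcanc
    TB colS TP s0max Ci0 CS swap_le C_closed sel).
exact/eqP.
Qed.
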